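(* Let $D$ be a diagram that contains no ghost cells. Then the map $f_D:GKD(D)\to GKD(f_D(D))$, $\tilde D\mapsto\tilde D\setminus S(D)$, is a well-defined bijection which preserves ghost cells (i.e. $\tilde D$ and $f_D(\tilde D)$ have the same set of ghost cells). Consequently, $\widehat{\mathrm{MaxG}}(D)=\widehat{\mathrm{MaxG}}(f_D(D))$.
   Context: A diagram is a finite set of cells at positions $(r,c)$ with $r,c$ positive integers ($r$ = row from the bottom, $c$ = column), at most one cell per position; each cell is either ordinary, written $(r,c)$, or a ghost cell, written $\langle r,c\rangle$. A position is empty if it contains no cell. Ghost move at row $r$ of $D$: let the rightmost cell of row $r$ (ghost or not) lie in column $c$. The move does nothing if that cell is a ghost cell, or every position $(r',c)$ with $r'<r$ is occupied, or, letting $\hat r<r$ be maximal with $(\hat r,c)$ empty, some $(r^*,c)$ with $\hat r<r^*<r$ holds a ghost cell. Otherwise it moves the cell from $(r,c)$ to $(\hat r,c)$ and places a ghost cell $\langle r,c\rangle$ at $(r,c)$. $GKD(D)$ is the set of $D$ and all diagrams obtained from $D$ by finite sequences of ghost moves; $\widehat{\mathrm{MaxG}}(D)$ is the maximum number of ghost cells in a diagram of $GKD(D)$. $R(D)$ is the set of ordinary cells $(r,c)\in D$ such that no cell (ordinary or ghost) of $D$ lies at $(r,\tilde c)$ with $\tilde c>c$. $S(D)=\{(r,c)\in D \text{ ordinary}: (r,c)\notin R(D) \text{ and } (r^*,c)\notin R(D)\ \forall r^*>r\}$, and $f_D(\tilde D)=\tilde D\setminus S(D)$ for $\tilde D\in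 GKD(D)$. *)

(* Defs.v *)
From HB Require Import structures.
From mathcomp Require Import all_boot finmap.
From mathcomp Require Import boolp classical_sets functions.

Set Implicit Arguments.
Unset Strict Implicit.
Unset Printing Implicit Defensive.

Local Open Scope fset_scope.
Local Open Scope nat_scope.

(* ((r, c), false) is the ordinary cell (r, c); ((r, c), true) is the ghost
   cell <r, c>. *)
Notation cell := (nat * nat * bool)%type.

Definition row (x : cell) : nat := x.1.1.
Definition col (x : cell) : nat := x.1.2.
Definition is_ghost (x : cell) : bool := x.2.
Definition ordinary (r c : nat) : cell := ((r, c), false).
Definition ghost (r c : nat) : cell := ((r, c), true).

Definition diagram_axiom (A : {fset cell}) : bool :=
  [forall x : A, (0 < row (val x)) && (0 < col (val x))] &&
  [forall x : A, forall y : A, ((val x).1 == (val y).1) ==> (x == y)].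

Record diagram := Diagram {
  cells :> {fset cell};
  _ : diagram_axiom cells
}.
HB.instance Definition _ := [isSub for cells].
HB.instance Definition _ := [Choice of diagram by <:].

Lemma diagram_axiomP (A : {fset cell}) :
  reflect ((forall x, x \in A -> 0 < row x /\ 0 < col x) /\
           (forall x y, x \in A -> y \in A -> x.1 = y.1 -> x = y))
          (diagram_axiom A).
Proof.
apply: (iffP andP) => -[pos inj]; split.
- by move=> x xA; have /andP := forallP pos [` xA].
- move=> x y xA yA e; have /forallP/(_ [` yA]) := forallP inj [` xA].
  by move/implyP => /(_ (introT eqP e)) /eqP/(congr1 val).
- by apply/forallP => -[x xA] /=; apply/andP; apply: pos.
- apply/forallP => x; apply/forallP => y; apply/implyP => /eqP e.
  by apply/eqP/val_inj/inj => //; apply: valP.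
Qed.

Definition occupied (D : diagram) (r c : nat) : bool :=
  (ordinary r c \in cells D) || (ghost r c \in cells D).

(* Column of the rightmost cell of row r; 0 when the row is empty. *)
Definition rightmost_col (D : diagram) (r : nat) : nat :=
  \max_(x <- cells D | row x == r) col x.

(* The largest row 1 <= r' < r with (r', c) empty; 0 when there is none. *)
Definition landing_row (D : diagram) (r c : nat) : nat :=
  \max_(1 <= r' < r | ~~ occupied D r' c) r'.

Definition can_move (D : diagram) (r : nat) : bool :=
  let c := rightmost_col D r in
  let r' := landing_row D r c in
  [&& ordinary r c \in cells D,
      0 < r' &
      all (fun s => ghost s c \notin cells D) (index_iota r'.+1 r)].

Definition ghost_move_cells (D : diagram) (r : nat) : {fset cell} :=
  let c := rightmost_col D r in
  let r' := landing_row D r c in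
  if can_move D r then
    ghost r c |` (ordinary r' c |` (cells D `\ ordinary r c))
  else cells D.

Lemma landing_rowP (D : diagram) (r c : nat) :
  0 < landing_row D r c ->
  landing_row D r c < r /\ ~~ occupied D (landing_row D r c) c.
Proof.
rewrite /landing_row big_seq_cond.
elim/big_ind: _ => // [x y Px Py|i /andP[]].
  by rewrite /maxn; case: ifP.
by rewrite mem_index_iota => /andP[_ lt_ir] free_i _.
Qed.

Lemma ghost_move_axiom (D : diagram) (r : nat) :
  diagram_axiom (ghost_move_cells D r).
Proof.
have dD := valP D; rewrite /ghost_move_cells; case: ifP => // /and3P[].
move: (rightmost_col D r) => c; set r' := landing_row D r c.
move=> rcD r'_gt0 _; have [lt_r'r free_r'] := landing_rowP r'_gt0.
have [pos inj] := diagram_axiomP _ dD; have [/= r_gt0 c_gt0] := pos _ rcD.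
have notD x : x \in cells D -> x.1 <> (r', c).
  by case: x => p [] + /= e; rewrite e => xD; case/norP: free_r' => /negP+ /negP.
have notrc x : x \in cells D -> x != ordinary r c -> x.1 <> (r, c).
  by move=> xD /eqP + e; apply; apply: inj.
have nrr : (r, c) <> (r', c) by case=> /eqP; rewrite gtn_eqF.
apply/diagram_axiomP; split=> [x|x y]; rewrite !inE.
  by case/or3P=> [/eqP->|/eqP->|/andP[_ /pos]].
case/or3P=> [/eqP->|/eqP->|/andP[xn xD]];
  case/or3P=> [/eqP->|/eqP->|/andP[yn yD]] //= e.
- by case: (notrc _ yD yn).
- by case: nrr.
- by case: (notD _ yD).
- by case: (notrc _ xD xn).
- by case: (notD _ xD).
- exact: inj.
Qed.

(* Nothing moves when row r is empty: rightmost_col D r is then 0, and no cell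
   has column 0; this includes r = 0. *)
Definition ghost_move (D : diagram) (r : nat) : diagram :=
  Diagram (ghost_move_axiom D r).

Definition GKD (D : diagram) : set diagram :=
  [set T | exists rows : seq nat, T = foldl ghost_move D rows]%classic.

Definition ghosts (D : diagram) : {fset cell} :=
  [fset x in cells D | is_ghost x].

(* R(D) *)
Definition rightmost_cells (D : diagram) : {fset cell} :=
  [fset x in cells D | ~~ is_ghost x &&
    [forall y : cells D, ~~ ((row (val y) == row x) && (col x < col (val y)))]].

(* S(D) *)
Definition static_cells (D : diagram) : {fset cell} :=
  [fset x in cells D | [&& ~~ is_ghost x, x \notin rightmost_cells D &
    [forall y : rightmost_cells D,
       ~~ ((row x < row (val y)) && (col (val y) == col x))]]].

Lemma diagram_axiomD (D : diagram) (A : {fset cell}) :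
  diagram_axiom (cells D `\` A).
Proof.
have [pos inj] := diagram_axiomP _ (valP D).
by apply/diagram_axiomP; split=> [x|x y] /fsetDP[xD _];
  [exact: pos|move=> /fsetDP[yD _]; exact: inj].
Qed.

(* f_D(T): the removed cells depend on D only, not on T. *)
Definition remove_static (D T : diagram) : diagram :=
  Diagram (diagram_axiomD T (static_cells D)).

Definition has_ghost_count (D : diagram) : pred nat :=
  fun n => `[< exists2 T, GKD D T & #|` ghosts T| = n >].

Lemma has_ghost_count_ex (D : diagram) : exists n, has_ghost_count D n.
Proof. by exists #|` ghosts D|; apply/asboolP; exists D => //; exists [::]. Qed.

Definition box (M N : nat) : seq cell :=
  [seq (p, b) | p <- [seq (r, c) | r <- iota 0 M.+1, c <- iota 0 N.+1],
                b <- [:: true; false]].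

Lemma mem_box (M N : nat) (x : cell) :
  (x \in box M N) = (row x <= M) && (col x <= N).
Proof.
case: x => -[r c] b; rewrite /row /col.
apply/allpairsP/andP.
  case=> -[p b'] [+ _ [e _]]; rewrite -e => /allpairsP[[r' c'] [+ + [-> ->]]].
  by rewrite !mem_iota !add0n !ltnS.
case=> rM cN; exists ((r, c), b); split=> //; last by case: (b).
by apply/allpairsP; exists (r, c); rewrite !mem_iota.
Qed.

Lemma GKD_box (M N : nat) (D T : diagram) :
  {subset cells D <= box M N} -> GKD D T -> {subset cells T <= box M N}.
Proof.
move=> sub [rows ->]; elim: rows D sub => //= r rows IH D sub.
apply: IH => x; rewrite /= /ghost_move_cells.
case: ifP => [/and3P[rcD r'_gt0 _]|_]; last exact: sub.
have [/ltnW lt_r'r _] := landing_rowP r'_gt0.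
have := sub _ rcD; rewrite mem_box /= => /andP[rM cN].
rewrite mem_box !inE; case/or3P=> [/eqP->|/eqP->|/andP[_ /sub]]; last by rewrite mem_box.
  by rewrite /= rM.
by rewrite /= cN (leq_trans lt_r'r).
Qed.

Definition ghost_bound (D : diagram) : nat :=
  size (box (\max_(x <- cells D) row x) (\max_(x <- cells D) col x)).

Lemma has_ghost_count_le (D : diagram) (n : nat) :
  has_ghost_count D n -> n <= ghost_bound D.
Proof.
move=> /asboolP[T DT <-]; apply: uniq_leq_size; first exact: fset_uniq.
move=> x; rewrite !inE /= => /andP[xT _]; apply: (GKD_box _ DT xT) => y yD.
by rewrite mem_box; apply/andP; split;
  [apply: (@leq_bigmax_seq _ _ xpredT row)|apply: (@leq_bigmax_seq _ _ xpredT col)].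
Qed.

Definition MaxG (D : diagram) : nat :=
  ex_maxn (has_ghost_count_ex D) (@has_ghost_count_le D).

(* Main.v *)
Require Import Defs.
From mathcomp Require Import all_boot finmap.
From mathcomp Require Import boolp classical_sets functions.

(** A ghost move never frees a position, so a cell of [D] that is not rightmost
in its row never becomes rightmost, and the cells of S(D) stay in place.
Moreover a moving cell of column [c] is, or descends from, a cell of R(D) in
column [c], so that no cell of S(D) lies below it.  Hence the cells of S(D)
influence neither which cell moves nor where it lands: removing them commutes
with every ghost move. *)

Local Open Scope fset_scope.
Local Open Scope nat_scope.

Lemma mem_occupied (D : diagram) (x : cell) :
  x \in cells D -> occupied D (row x) (col x).
Proof. by case: x => -[r c] [] xD; rewrite /occupied /= xD ?orbT. Qed.

Lemma leq_rightmost_col (D : diagram) (r c : nat) :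
  occupied D r c -> c <= rightmost_col D r.
Proof.
by case/orP=> xD;
  apply: (@leq_bigmax_seq _ _ (fun x => row x == r) col _ xD); rewrite /= eqxx.
Qed.

Lemma rightmost_col_occupied (D : diagram) (r : nat) :
  0 < rightmost_col D r -> occupied D r (rightmost_col D r).
Proof.
rewrite /rightmost_col big_seq_cond.
elim/big_ind: _ => // [x y Px Py|x /andP[xD /eqP <-] _].
  by rewrite /maxn; case: ifP.
exact: mem_occupied.
Qed.

(** The only vacated position is refilled at once by the new ghost cell. *)
Lemma ghost_move_occupied (T : diagram) (r s c : nat) :
  occupied T s c -> occupied (ghost_move T r) s c.
Proof.
rewrite /occupied /= /ghost_move_cells; case: ifP => // _.
move: (rightmost_col T r) => d; rewrite !inE.
have [[-> ->]|ne] := eqVneq (s, c) (r, d); first by rewrite (eqxx (ghost r d)) !orbT.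
have -> /= : ghost s c != ordinary r d by apply/eqP.
have -> /= : ordinary s c != ordinary r d.
  by apply: contra ne => /eqP[-> ->].
by case/orP=> ->; rewrite !orbT.
Qed.

(** Induction on the last move rather than the first: [D] stays fixed, and each step still knows
    that the diagram being moved lies in [GKD D]. *)
Lemma GKD_ind (D : diagram) (P : diagram -> Prop) :
  P D -> (forall T r, GKD D T -> P T -> P (ghost_move T r)) ->
  forall T, GKD D T -> P T.
Proof.
move=> PD Pmove T [rows ->]; elim/last_ind: rows => // rows r IH.
by rewrite foldl_rcons; apply: Pmove => //; exists rows.
Qed.

Lemma GKD_occupied (D T : diagram) (r c : nat) :
  GKD D T -> occupied D r c -> occupied T r c.
Proof.
move=> DT Drc; elim/GKD_ind: T / DT => // T s _; exact: ghost_move_occupied.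
Qed.

Lemma ordinary_rightmost_cells (D : diagram) (r c : nat) :
  (ordinary r c \in rightmost_cells D) =
  (ordinary r c \in cells D) && (rightmost_col D r <= c).
Proof.
rewrite !inE /=; case: (boolP (ordinary r c \in cells D)) => //= rcD.
apply/forallP/idP => [maxc|lec y].
  (* The value 0 need not point at an actual cell, so it is split off; the bound is then trivial. *)
  case: (posnP (rightmost_col D r)) => [->//|/rightmost_col_occupied].
  by rewrite leqNgt => /orP[] yD; have := maxc [` yD]; rewrite /= eqxx.
apply/negP => /andP[/eqP yr]; apply/negP; rewrite -leqNgt.
by apply: leq_trans lec; rewrite -[r]yr leq_rightmost_col ?mem_occupied ?fsvalP.
Qed.

Lemma static_cellsP (D : diagram) (x : cell) :
  x \in static_cells D ->
  [/\ x \in cells D, x = ordinary (row x) (col x),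
      col x < rightmost_col D (row x)
    & forall r, ordinary r (col x) \in rightmost_cells D -> r <= row x].
Proof.
case: x => -[s c] b; rewrite inE /= => /andP[xD /and3P[]].
case: b xD => // xD _ notR /forallP above; split=> //.
  by move: notR; rewrite ordinary_rightmost_cells xD /= -ltnNge.
move=> r rR; have := above [` rR].
by rewrite /= eqxx andbT -leqNgt.
Qed.

(** If the moving cell already belongs to [D], it is rightmost in [D] too, since positions occupied
    in [D] stay occupied in [T]. The origin property is a hypothesis so that the induction proving
    it can use this lemma. *)
Lemma rightmost_cells_origin (D T : diagram) (r : nat) (DT : GKD D T) :
  (forall s c, ordinary s c \in cells T ->
     ordinary s c \in cells D \/
     exists2 s', s <= s' & ordinary s' c \in rightmost_cells D) ->
  ordinary r (rightmost_col T r) \in cells T ->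
  exists2 r', r <= r' & ordinary r' (rightmost_col T r) \in rightmost_cells D.
Proof.
move=> origin /origin[rcD|//]; exists r => //.
rewrite ordinary_rightmost_cells rcD /=.
case: (posnP (rightmost_col D r)) => [->//|/rightmost_col_occupied].
by move/(GKD_occupied _ _ _ _ DT)/leq_rightmost_col.
Qed.

Lemma GKD_origin (D T : diagram) (s c : nat) :
  GKD D T -> ordinary s c \in cells T ->
  ordinary s c \in cells D \/
  exists2 s', s <= s' & ordinary s' c \in rightmost_cells D.
Proof.
move=> DT; elim/GKD_ind: T / DT s c => [|T r DT IH] s c; first by left.
rewrite /= /ghost_move_cells; case: ifP => [/and3P[rT lr_gt0 _]|_]; last exact: IH.
have [r' le_rr' r'R] := rightmost_cells_origin D T r DT IH rT.
have [/ltnW lt_lr _] := landing_rowP lr_gt0.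
rewrite !inE => /orP[/eqP//|/orP[/eqP[-> ->]|/andP[_ /IH//]]].
(* The moved cell only goes down its column, so the origin found before the move still serves. *)
by right; exists r' => //; apply: leq_trans le_rr'.
Qed.

(** The moving cell comes from a cell of R(D) in the same column, at row [r] or higher, whereas no
    cell of R(D) lies above a static cell. *)
Lemma static_cells_not_below (D T : diagram) (r s : nat) :
  GKD D T -> ordinary r (rightmost_col T r) \in cells T -> s < r ->
  ordinary s (rightmost_col T r) \notin static_cells D.
Proof.
move=> DT rT lt_sr; apply/negP => /static_cellsP[_ _ _ above].
have [r' le_rr' /above] :=
  rightmost_cells_origin D T r DT (fun s c => GKD_origin D T s c DT) rT.
by rewrite leqNgt /row /= (leq_trans lt_sr).
Qed.

(** In [D] some cell lies to the right of a static cell, and its position remains occupied in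
    [T]. *)
Lemma static_cells_not_rightmost (D T : diagram) (r : nat) :
  GKD D T -> ordinary r (rightmost_col T r) \notin static_cells D.
Proof.
move=> DT; apply/negP => /static_cellsP[_ _ lt_col _].
have /rightmost_col_occupied := leq_ltn_trans (leq0n _) lt_col.
move/(GKD_occupied _ _ _ _ DT)/leq_rightmost_col.
by rewrite leqNgt lt_col.
Qed.

Lemma ghost_notin_static (D : diagram) (r c : nat) :
  ghost r c \notin static_cells D.
Proof. by apply/negP => /static_cellsP[]. Qed.

(** A move takes away only the rightmost ordinary cell of a row, which is never static. *)
Lemma static_cells_sub (D T : diagram) :
  GKD D T -> static_cells D `<=` cells T.
Proof.
move=> DT; elim/GKD_ind: T / DT => [|T r DT /fsubsetP sub]; apply/fsubsetP => x xS.
  by have [] := static_cellsP _ _ xS.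
rewrite /= /ghost_move_cells; case: ifP => _; last exact: sub.
rewrite !inE sub // andbT.
have -> : x != ordinary r (rightmost_col T r).
  by apply: contraNneq (static_cells_not_rightmost D T r DT) => <-.
by rewrite !orbT.
Qed.

Lemma occupied_remove_static (D T : diagram) (r c : nat) :
  ordinary r c \notin static_cells D ->
  occupied (remove_static D T) r c = occupied T r c.
Proof.
by move=> nS; rewrite /occupied /= !in_fsetD nS ghost_notin_static.
Qed.

Lemma rightmost_col_remove_static (D T : diagram) (r : nat) :
  GKD D T -> rightmost_col (remove_static D T) r = rightmost_col T r.
Proof.
move=> DT; apply/eqP; rewrite eqn_leq; apply/andP; split.
  case: (posnP (rightmost_col (remove_static D T) r)) => [->//|].
  move/rightmost_col_occupied => occ; apply: leq_rightmost_col.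
  by case/orP: occ; rewrite /occupied !in_fsetD => /andP[_ ->]; rewrite ?orbT.
case: (posnP (rightmost_col T r)) => [->//|/rightmost_col_occupied occ].
by rewrite leq_rightmost_col // occupied_remove_static // static_cells_not_rightmost.
Qed.

(** All data governing the move agree in both diagrams: the column, the presence of an ordinary cell
    there, the landing row and the blocking ghosts. *)
Lemma ghost_move_remove_static (D T : diagram) (r : nat) :
  GKD D T ->
  ghost_move (remove_static D T) r = remove_static D (ghost_move T r).
Proof.
move=> DT; apply: val_inj => /=; rewrite /ghost_move_cells /can_move.
rewrite rightmost_col_remove_static //.
set c := rightmost_col T r.
have nS_rc : ordinary r c \notin static_cells D by apply: static_cells_not_rightmost.
rewrite /= in_fsetD nS_rc /=; case: (boolP (ordinary r c \in cells T)) => //= rT.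
have nS s : s < r -> ordinary s c \notin static_cells D.
  exact: static_cells_not_below.
(* The landing row only depends on positions below row [r] in column [c], none of them static. *)
have -> : landing_row (remove_static D T) r c = landing_row T r c.
  apply: congr_big_nat => // s /andP[_ lt_sr].
  by rewrite occupied_remove_static // nS.
set r' := landing_row T r c.
under eq_all do rewrite in_fsetD ghost_notin_static.
(* Neither added cell is static, so adding them commutes with removing S(D). *)
case: ifP => // /andP[/landing_rowP[lt_r'r _] _].
apply/fsetP => x; rewrite 2!in_fset1U in_fsetD1 !in_fsetD 2!in_fset1U in_fsetD1.
have [->|_] /= := eqVneq x (ghost r c); first by rewrite ghost_notin_static.
have [->|_] /= := eqVneq x (ordinary r' c); first by rewrite nS.
by rewrite andbCA.
Qed.

Lemma foldl_remove_static (D : diagram) (rows : seq nat) :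
  foldl ghost_move (remove_static D D) rows =
  remove_static D (foldl ghost_move D rows).
Proof.
elim/last_ind: rows => // rows r IH.
by rewrite !foldl_rcons IH ghost_move_remove_static //; exists rows.
Qed.

Lemma ghosts_remove_static (D T : diagram) :
  ghosts (remove_static D T) = ghosts T.
Proof.
by apply/fsetP => -[[r c] []]; rewrite !inE /= ?andbF.
Qed.

Lemma remove_static_bij (D : diagram) :
  set_bij (GKD D) (GKD (remove_static D D)) (remove_static D).
Proof.
split.
- by move=> _ [rows ->]; exists rows; rewrite foldl_remove_static.
- move=> T U /set_mem DT /set_mem DU /(congr1 val) /= eTU; apply: val_inj => /=.
  apply/fsetP => x; have /fsetP/(_ x) := eTU; rewrite !in_fsetD.
  (* The equation of images decides membership outside S(D); inside, both [T] and [U] contain all of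
     S(D). *)
  case: (boolP (x \in static_cells D)) => //= xS _.
  by rewrite !(fsubsetP (static_cells_sub D _ _) x xS).
(* A preimage is obtained by playing the same sequence of rows from [D]. *)
- move=> _ [rows ->]; exists (foldl ghost_move D rows); first by exists rows.
  by rewrite foldl_remove_static.
Qed.

Lemma has_ghost_count_remove_static (D : diagram) (n : nat) :
  has_ghost_count (remove_static D D) n = has_ghost_count D n.
Proof.
have [fGKD _ surj] := remove_static_bij D.
apply/asboolP/asboolP => [[_ /surj[T DT <-]]|[T DT]].
  by rewrite ghosts_remove_static; exists T.
by exists (remove_static D T); [apply: fGKD|rewrite ghosts_remove_static].
Qed.

Lemma MaxG_remove_static (D : diagram) : MaxG (remove_static D D) = MaxG D.
Proof. exact/eq_ex_maxn/has_ghost_count_remove_static. Qed.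

Theorem theorem4p8 (D : diagram) (noghost : ghosts D = fset0) :
  [/\ set_bij (GKD D) (GKD (remove_static D D)) (remove_static D),
      (forall T : diagram, GKD D T -> ghosts (remove_static D T) = ghosts T)
    & MaxG D = MaxG (remove_static D D)].
Proof.
split; [exact: remove_static_bij|by move=> T _; apply: ghosts_remove_static|].
by rewrite MaxG_remove_static.
Qed.
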